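(* Let $a>1$, $n\ge 1$ an integer, $x\in\mathbb{R}$ and $g\in L^2(\mathbb{R})$. For $j=0,1,\dots,n$ set $\omega_j=1-\frac{2j}{n}$. Let $S^{g,x}_n(t,a):=F_n(t,a)\,g(t-x)$. Then for every $(u,\eta)\in\mathbb{R}^2$, $$V_g\left(S^{g,x}_{n}\right)(u,\eta)=\sum_{j=0}^{n}C_j(n,a)\,K_g(x,\omega_j;u,\eta),$$ that is, $$V_g\left(S^{g,x}_{n}\right)(u,\eta)=\sum_{j=0}^{n}C_j(n,a)\,\langle M_{\omega_j}T_x g, M_\eta T_u g\rangle_{L^2(\mathbb{R})}.$$
   Context: $(T_xf)(t)=f(t-x)$ and $(M_\omega f)(t)=e^{i\omega t}f(t)$. The inner product is $\langle f,h\rangle_{L^2(\mathbb{R})}=\int_{\mathbb{R}}f(t)\overline{h(t)}\,dt$. The short-time Fourier transform of $f\in L^2(\mathbb{R})$ with window $g\in L^2(\mathbb{R})$ is $V_g(f)(x,\omega)=\int_{\mathbb{R}}e^{-it\omega}\overline{g(t-x)}f(t)\,dt$. The Gabor kernel is $K_g(x,\omega;u,\eta)=\langle M_\omega T_xg,M_\eta T_ug\rangle_{L^2(\mathbb{R})}$. The superoscillating sequence is $F_n(t,a)=\sum_{j=0}^nC_j(n,a)e^{i(1-2j/n)t}$ with $C_j(n,a)=\binom{n}{j}\left(\frac{1+a}{2}\right)^{n-j}\left(\frac{1-a}{2}\right)^j$. *)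

(* Defs.v *)
From HB Require Import structures.
From mathcomp Require Import all_boot all_order all_algebra.
From mathcomp Require Import all_classical all_reals all_analysis.
From mathcomp Require Import complex.

Set Implicit Arguments.
Unset Strict Implicit.
Unset Printing Implicit Defensive.

Import Order.TTheory GRing.Theory Num.Theory.

Local Open Scope classical_set_scope.
Local Open Scope ring_scope.
Local Open Scope complex_scope.

Definition expi (R : realType) (theta : R) : R[i] := cos theta +i* sin theta.

(* An element of L^2(R; C) is given by a Borel representative; [Lfun] in the
   library is real-valued, so it does not apply directly. *)
Definition L2C (R : realType) (f : R -> R[i]) : Prop :=
  [/\ measurable_fun setT (fun t => complex.Re (f t)),
      measurable_fun setT (fun t => complex.Im (f t)) &
      (\int[@lebesgue_measure R]_t
         ((ComplexField.Normc.normc (f t)) ^+ 2)%:E < +oo)%E].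

Definition cintegral (R : realType) (f : R -> R[i]) : R[i] :=
  (\int[@lebesgue_measure R]_t complex.Re (f t)) +i*
  (\int[@lebesgue_measure R]_t complex.Im (f t)).

Definition inner (R : realType) (f h : R -> R[i]) : R[i] :=
  cintegral (fun t => f t * (h t)^*%C).

Definition translation (R : realType) (x : R) (f : R -> R[i]) : R -> R[i] :=
  fun t => f (t - x).

Definition modulation (R : realType) (omega : R) (f : R -> R[i]) : R -> R[i] :=
  fun t => expi (omega * t) * f t.

Definition stft (R : realType) (g f : R -> R[i]) (x omega : R) : R[i] :=
  cintegral (fun t => expi (- (t * omega)) * (g (t - x))^*%C * f t).

Definition gabor_kernel (R : realType) (g : R -> R[i])
    (x omega u eta : R) : R[i] :=
  inner (modulation omega (translation x g)) (modulation eta (translation u g)).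

Definition superosc_coef (R : realType) (n : nat) (a : R) (j : nat) : R :=
  'C(n, j)%:R * ((1 + a) / 2) ^+ (n - j) * ((1 - a) / 2) ^+ j.

Definition superosc_freq (R : realType) (n j : nat) : R :=
  1 - 2 * j%:R / n%:R.

Definition superosc (R : realType) (n : nat) (t a : R) : R[i] :=
  \sum_(j < n.+1) (superosc_coef n a j)%:C * expi (superosc_freq R n j * t).

Definition windowed_superosc (R : realType) (g : R -> R[i]) (x : R) (n : nat)
    (a : R) : R -> R[i] :=
  fun t => superosc n t a * g (t - x).

(* Main.v *)
Require Import Defs.
From HB Require Import structures.
From mathcomp Require Import all_boot all_order all_algebra.
From mathcomp Require Import all_classical all_reals all_analysis.
From mathcomp Require Import measurable_realfun complex ring lra.
Local Open Scope ring_scope.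
Local Open Scope complex_scope.

Set Implicit Arguments.
Unset Strict Implicit.

Import Order.TTheory GRing.Theory Num.Theory.

(** The transform is linear in the signal, and the signal is a finite linear
    combination of the time-frequency shifts [M_{omega_j} T_x g].  Pointwise,
    [expi (- (t * eta))] is the conjugate of [expi (eta * t)], so the integrand
    of [stft g (M_omega T_x g) u eta] is the one of
    [inner (M_omega T_x g) (M_eta T_u g)], and the integrand on the left-hand
    side is the corresponding finite sum ([stft_integrand_superosc]).

    What has to be proved is that the integral may be exchanged with the sum,
    which requires every summand to be integrable: the integral of a
    function that is not integrable is given a conventional value, for which
    additivity can fail.  Integrability comes from [g] being square
    integrable: modulations do not change the modulus, translations preserve
    Lebesgue measure ([lebesgue_measure_translation]), hence both factors of
    each inner product lie in L^2, and a product of two functions of L^2 is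
    integrable by [2 |f h| <= |f|^2 + |h|^2] ([L2C_mulJ_integrable]). *)

(** * Integration of complex-valued functions *)

Definition cintegrable (R : realType) (f : R -> R[i]) : Prop :=
  (@lebesgue_measure R).-integrable setT (EFin \o (fun t => complex.Re (f t)))
  /\
  (@lebesgue_measure R).-integrable setT (EFin \o (fun t => complex.Im (f t))).

Lemma Re_add (R : realType) (z w : R[i]) :
  complex.Re (z + w) = complex.Re z + complex.Re w.
Proof. by case: z w => [? ?] [? ?]. Qed.

Lemma Im_add (R : realType) (z w : R[i]) :
  complex.Im (z + w) = complex.Im z + complex.Im w.
Proof. by case: z w => [? ?] [? ?]. Qed.

Lemma Re_mul (R : realType) (z w : R[i]) :
  complex.Re (z * w) =
  complex.Re z * complex.Re w - complex.Im z * complex.Im w.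
Proof. by case: z w => [? ?] [? ?]. Qed.

Lemma Im_mul (R : realType) (z w : R[i]) :
  complex.Im (z * w) =
  complex.Re z * complex.Im w + complex.Im z * complex.Re w.
Proof. by case: z w => [? ?] [? ?]. Qed.

Lemma Re_conjc (R : realType) (z : R[i]) : complex.Re z^*%C = complex.Re z.
Proof. by case: z. Qed.

Lemma Im_conjc (R : realType) (z : R[i]) : complex.Im z^*%C = - complex.Im z.
Proof. by case: z. Qed.

Lemma normc_sqr (R : realType) (z : R[i]) :
  ComplexField.Normc.normc z ^+ 2 = complex.Re z ^+ 2 + complex.Im z ^+ 2.
Proof. by case: z => p q /=; rewrite sqr_sqrtr// addr_ge0// sqr_ge0. Qed.

Section cintegral_linear.
Context {R : realType}.
Implicit Types (f h : R -> R[i]) (c : R[i]).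

Let mu := @lebesgue_measure R.

Let integrableZl_fin (r : R) (k : R -> R) :
  mu.-integrable setT (EFin \o k) ->
  mu.-integrable setT (EFin \o (fun t => r * k t)).
Proof.
by move=> ik; have := integrableZl measurableT r ik.
Qed.

Let integrableD_fin (k l : R -> R) :
  mu.-integrable setT (EFin \o k) -> mu.-integrable setT (EFin \o l) ->
  mu.-integrable setT (EFin \o (fun t => k t + l t)).
Proof.
by move=> ik il; have := integrableD measurableT ik il.
Qed.

Let integrableB_fin (k l : R -> R) :
  mu.-integrable setT (EFin \o k) -> mu.-integrable setT (EFin \o l) ->
  mu.-integrable setT (EFin \o (fun t => k t - l t)).
Proof.
by move=> ik il; have := integrableB measurableT ik il.
Qed.

Lemma cintegrable0 : cintegrable (fun _ : R => 0 : R[i]).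
Proof. by split; exact: integrable0. Qed.

Lemma cintegrableD f h : cintegrable f -> cintegrable h ->
  cintegrable (fun t => f t + h t).
Proof.
move=> [Rf If] [Rh Ih]; split.
- by under [X in _ \o X]eq_fun do rewrite Re_add; exact: integrableD_fin.
- by under [X in _ \o X]eq_fun do rewrite Im_add; exact: integrableD_fin.
Qed.

Lemma cintegrableZl c f : cintegrable f -> cintegrable (fun t => c * f t).
Proof.
move=> [Rf If]; split.
- under [X in _ \o X]eq_fun do rewrite Re_mul.
  by apply: integrableB_fin; exact: integrableZl_fin.
- under [X in _ \o X]eq_fun do rewrite Im_mul.
  by apply: integrableD_fin; exact: integrableZl_fin.
Qed.

Lemma cintegral0 : cintegral (fun _ : R => 0 : R[i]) = 0.
Proof. by rewrite /cintegral /= !Rintegral_cst// !mul0r. Qed.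

Lemma cintegralD f h : cintegrable f -> cintegrable h ->
  cintegral (fun t => f t + h t) = cintegral f + cintegral h.
Proof.
move=> [Rf If] [Rh Ih]; rewrite /cintegral.
under eq_Rintegral do rewrite Re_add.
under [in X in _ +i* X]eq_Rintegral do rewrite Im_add.
by rewrite !RintegralD.
Qed.

Lemma cintegralZl c f : cintegrable f ->
  cintegral (fun t => c * f t) = c * cintegral f.
Proof.
move=> [Rf If]; rewrite /cintegral.
under eq_Rintegral do rewrite Re_mul.
under [in X in _ +i* X]eq_Rintegral do rewrite Im_mul.
rewrite RintegralB ?RintegralD ?RintegralZl//; last 4 first.
- exact: integrableZl_fin.
- exact: integrableZl_fin.
- exact: integrableZl_fin.
- exact: integrableZl_fin.
by case: c.
Qed.

(** Integrability of the tail of the sum is needed to add the next term, so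
    it is proved together with the formula. *)
Lemma cintegral_lincomb (I : Type) (s : seq I) (c : I -> R[i])
    (f : I -> R -> R[i]) : (forall i, cintegrable (f i)) ->
  cintegral (fun t => \sum_(i <- s) c i * f i t) =
  \sum_(i <- s) c i * cintegral (f i).
Proof.
move=> If.
suff [] : cintegrable (fun t => \sum_(i <- s) c i * f i t) /\
  cintegral (fun t => \sum_(i <- s) c i * f i t) =
  \sum_(i <- s) c i * cintegral (f i) by [].
elim: s => [|i s [IHi IHe]].
  under eq_fun do rewrite big_nil.
  by rewrite big_nil cintegral0; split => //; exact: cintegrable0.
under eq_fun do rewrite big_cons.
have Ii := cintegrableZl (c i) (If i).
split; first exact: cintegrableD.
by rewrite cintegralD// cintegralZl// IHe big_cons.
Qed.

End cintegral_linear.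

(** * Square-integrable functions, translation and modulation *)

(** The domain and codomain are the type carrying [lebesgue_measure], so that
    the image of that measure is again recognized as a measure on it. *)
Definition shift_by (R : realType) (x : R) :
  measurableTypeR R -> measurableTypeR R := fun t : R => t - x.

Lemma measurable_shift_by (R : realType) (x : R) :
  measurable_fun setT (shift_by x).
Proof. exact: measurable_funB. Qed.

HB.instance Definition _ (R : realType) (x : R) :=
  isMeasurableFun.Build _ _ _ _ (shift_by x) (measurable_shift_by x).

(** A translation maps half-open intervals to half-open intervals of the same
    length, and these determine Lebesgue measure. *)
Lemma lebesgue_measure_translation (R : realType) (x : R)
    (A : set (measurableTypeR R)) : measurable A ->
  pushforward lebesgue_measure (shift_by x) A = lebesgue_measure A.
Proof.
move=> mA; symmetry.
apply: (@lebesgue_measure_unique R (pushforward lebesgue_measure (shift_by x)))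
  => //.
move=> _ [[a b] _ <-] /=.
rewrite /pushforward.
have -> : (shift_by x @^-1` `]a, b]%classic)%classic = `]a + x, b + x]%classic.
  apply/seteqP; split => t /=; rewrite !in_itv/= /shift_by;
  by rewrite ltrBrDr lerBlDr.
rewrite !lebesgue_measure_itv/= !lte_fin ltrD2r.
by case: ifP => // _; rewrite -!EFinB; congr EFin; ring.
Qed.

Lemma ge0_integral_translation (R : realType) (x : R) (f : R -> \bar R) :
  measurable_fun setT f -> (forall t, (0 <= f t)%E) ->
  (\int[@lebesgue_measure R]_t f ((t : R) - x)%R =
   \int[@lebesgue_measure R]_t f t)%E.
Proof.
move=> mf f0.
rewrite -(@eq_measure_integral _ _ _ setT lebesgue_measure
  (pushforward lebesgue_measure (shift_by x)) f); last first.
  by move=> A mA _; exact: lebesgue_measure_translation.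
by rewrite (ge0_integral_pushforward (measurable_shift_by x)).
Qed.

Lemma measurable_expi (R : realType) (omega : R) :
  measurable_fun setT (fun t : R => complex.Re (expi (omega * t))) /\
  measurable_fun setT (fun t : R => complex.Im (expi (omega * t))).
Proof.
have mo : measurable_fun setT (fun t : R => omega * t) by exact: measurable_funM.
split; apply: measurableT_comp mo; apply: continuous_measurable_fun.
- exact: continuous_cos.
- exact: continuous_sin.
Qed.

Lemma L2C_translation (R : realType) (x : R) (f : R -> R[i]) :
  L2C f -> L2C (translation x f).
Proof.
move=> [mRe mIm f2]; have mx := measurable_shift_by x.
split.
- exact: (measurableT_comp mRe mx).
- exact: (measurableT_comp mIm mx).
rewrite /translation (ge0_integral_translation x
  (f := fun t => (ComplexField.Normc.normc (f t) ^+ 2)%:E))//.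
- apply/measurable_EFinP; under eq_fun do rewrite normc_sqr.
  by apply: measurable_funD; exact: measurable_funX.
- by move=> t; rewrite lee_fin sqr_ge0.
Qed.

Lemma L2C_modulation (R : realType) (omega : R) (f : R -> R[i]) :
  L2C f -> L2C (modulation omega f).
Proof.
move=> [mRe mIm f2]; have [mc ms] := measurable_expi omega.
split.
- under eq_fun do rewrite Re_mul.
  by apply: measurable_funB; exact: measurable_funM.
- under eq_fun do rewrite Im_mul.
  by apply: measurable_funD; exact: measurable_funM.
under eq_integral do rewrite ComplexField.Normc.normcM exprMn normc_sqr
  /= cos2Dsin2 mul1r.
exact: f2.
Qed.

Lemma normr_dot2_le (R : realDomainType) (a c b d : R) :
  `|a * b + c * d| <= (a ^+ 2 + c ^+ 2) + (b ^+ 2 + d ^+ 2).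
Proof.
have := (sqr_ge0 (a - b), sqr_ge0 (c - d), sqr_ge0 (a + b), sqr_ge0 (c + d)).
have := (sqr_ge0 a, sqr_ge0 b, sqr_ge0 c, sqr_ge0 d).
move=> [[[? ?] ?] ?] [[[? ?] ?] ?].
by rewrite ler_norml; apply/andP; split; nra.
Qed.

(** The pointwise inequality [2 |f h| <= |f|^2 + |h|^2] provides an
    integrable majorant of both components of the product. *)
Lemma L2C_mulJ_integrable (R : realType) (f h : R -> R[i]) :
  L2C f -> L2C h -> cintegrable (fun t => f t * (h t)^*%C).
Proof.
have sqr_int k : L2C k -> (@lebesgue_measure R).-integrable setT
    (EFin \o (fun t => ComplexField.Normc.normc (k t) ^+ 2)).
  move=> [mRe mIm k2]; apply/integrableP; split.
    apply/measurable_EFinP; under eq_fun do rewrite normc_sqr.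
    by apply: measurable_funD; exact: measurable_funX.
  under eq_integral do rewrite gee0_abs ?lee_fin ?sqr_ge0//.
  exact: k2.
move=> Lf Lh; have := integrableD measurableT (sqr_int f Lf) (sqr_int h Lh).
case: Lf Lh => [mfR mfI _] [mhR mhI _] maj.
split; apply: le_integrable maj => //.
- apply/measurable_EFinP.
  under eq_fun do rewrite Re_mul Re_conjc Im_conjc mulrN opprK.
  by apply: measurable_funD; exact: measurable_funM.
- move=> t _ /=; rewrite lee_fin Re_mul Re_conjc Im_conjc !normc_sqr.
  rewrite [leRHS]ger0_norm ?addr_ge0 ?sqr_ge0// mulrN opprK.
  exact: normr_dot2_le.
- apply/measurable_EFinP.
  under eq_fun do rewrite Im_mul Re_conjc Im_conjc mulrN addrC.
  by apply: measurable_funB; exact: measurable_funM.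
- move=> t _ /=; rewrite lee_fin Im_mul Re_conjc Im_conjc !normc_sqr.
  rewrite [leRHS]ger0_norm ?addr_ge0 ?sqr_ge0//.
  have := normr_dot2_le (complex.Re (f t)) (complex.Im (f t))
    (- complex.Im (h t)) (complex.Re (h t)).
  by rewrite sqrrN [X in _ <= _ + X]addrC.
Qed.

(** * Superoscillations *)

Lemma expiN (R : realType) (theta : R) : expi (- theta) = (expi theta)^*%C.
Proof. by rewrite /expi cosN sinN. Qed.

Lemma stft_integrand_superosc (R : realType) (a : R) (n : nat) (x : R)
    (g : R -> R[i]) (u eta t : R) :
  expi (- (t * eta)) * (g (t - u))^*%C * windowed_superosc g x n a t =
  \sum_(j < n.+1) (superosc_coef n a j)%:C *
    (modulation (superosc_freq R n j) (translation x g) t *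
     (modulation eta (translation u g) t)^*%C).
Proof.
rewrite /windowed_superosc /superosc mulr_suml mulr_sumr.
apply: eq_bigr => j _.
rewrite /modulation /translation rmorphM/= expiN [t * eta]mulrC.
ring.
Qed.

Theorem theorem3p4 (R : realType) (a : R) (ha : 1 < a) (n : nat)
    (hn : (1 <= n)%N) (x : R) (g : R -> R[i]) (hg : L2C g) :
  forall u eta : R,
    stft g (windowed_superosc g x n a) u eta =
      \sum_(j < n.+1)
        (superosc_coef n a j)%:C * gabor_kernel g x (superosc_freq R n j) u eta
    /\
    stft g (windowed_superosc g x n a) u eta =
      \sum_(j < n.+1)
        (superosc_coef n a j)%:C *
        inner (modulation (superosc_freq R n j) (translation x g))
              (modulation eta (translation u g)).
Proof.
(* [gabor_kernel] unfolds to [inner], so the two equations are one. *)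
move=> u eta.
suff e : stft g (windowed_superosc g x n a) u eta =
    \sum_(j < n.+1) (superosc_coef n a j)%:C *
      inner (modulation (superosc_freq R n j) (translation x g))
            (modulation eta (translation u g)) by split.
rewrite /stft; under [X in cintegral X]eq_fun do rewrite stft_integrand_superosc.
rewrite (cintegral_lincomb _ (fun j : 'I_n.+1 => (superosc_coef n a j)%:C))// => j.
by apply: L2C_mulJ_integrable; apply: L2C_modulation; exact: L2C_translation.
Qed.
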